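(* Let the data $(Z_i,R_i)$, $i=1,2,\dotsc$, from matched pairs be generated i.i.d. from a distribution $F$ under which treatment is randomly assigned within pairs (possibly with a non-zero treatment effect). For each number of pairs $I$, let $T=T_I$ be the signed score statistic with scores $q_1,\dotsc,q_I$, let $\overline{T}_\Gamma$ ($\Gamma>0$) be its bounding variable, and let $\sigma_{q,I}^2=\dfrac{I^{-1}\sum_{i=1}^I q_i^2}{\big(I^{-1}\sum_{i=1}^I q_i\big)^2}$ (all as defined in the context). Assume: (i) for every fixed $\Gamma>0$, conditionally on the scores (for almost every realization of the data), $$\sqrt{I}\cdot\frac{\overline{T}_\Gamma-\Gamma/(1+\Gamma)}{\sqrt{\Gamma/(1+\Gamma)^2\,\sigma_{q,I}^2}}\overset{d}{\to}\mathrm{N}(0,1)\quad\text{as } I\to\infty;$$ (ii) the limit $\lim_{I\to\infty}\sigma_{q,I}^2=\sigma_q^2$ exists (almost surely, with $\sigma_q^2$ a finite constant); (iii) there are constants $\mu_F$ and $\sigma_F>0$ such that, under $F$, $$\sqrt{I}\cdot\frac{T-\mu_F}{\sigma_F}\overset{d}{\to}\mathrm{N}(0,1)\quad\text{as } I\to\infty.$$ Then for every fixed $0<\alpha<1$ the transformed sensitivity value $\kappa_\alpha^*$ satisfies, as $I\to\infty$, $$\sqrt{I}\cdot\big[\kappa_\alpha^*-\mu_F\big]\overset{d}{\to}\mathrm{N}\Big(-\sigma_q\,\bar{\Phi}^{-1}(\alpha)\sqrt{\mu_F(1-\mu_F)},\ \sigma_F^2\Big),$$ where $\sigma_q=\sqrt{\sigma_q^2}$,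 $\Phi$ is the CDF of the standard normal distribution and $\bar{\Phi}(y)=1-\Phi(y)$ is its complementary CDF.
   Context: Matched pairs. There are $I$ independent matched pairs, each with two subjects $j=1,2$, exactly one treated ($Z_{ij}=1$) and one control ($Z_{ij}=0$). Subject $j$ of pair $i$ has potential outcomes $r_{Tij}$ (under treatment) and $r_{Cij}$ (under control), observed covariates $x_{ij}$ with $x_{i1}=x_{i2}$, and an unmeasured confounder $u_{ij}$. The observed outcome is $R_{ij}=Z_{ij}r_{Tij}+(1-Z_{ij})r_{Cij}$, and the treated-minus-control difference is $Y_i=(Z_{i1}-Z_{i2})(R_{i1}-R_{i2})$. With $Z_i=(Z_{i1},Z_{i2})$ and $R_i=(R_{i1},R_{i2})$, the pairs $(Z_i,R_i)$ are i.i.d. Random assignment means that, given all the $(r_{Tij},r_{Cij},x_{ij},u_{ij})$ and given $Z_{i1}+Z_{i2}=1$ for all $i$, one has $\mathrm{P}(Z_{i1}=1)=1/2$, independently across pairs. Signed score statistic. Let $\mathrm{sgn}(y)=1_{y>0}$. The scores $q_i\ge 0$ are determined by the absolute differences $|Y_1|,\dotsc,|Y_I|$ (for example $q_i=\mathrm{rank}(|Y_i|)$; they may depend on $I$), with $q_i=0$ if $Y_i=0$; assume $\sum_{i=1}^I q_i>0$. The statistic is $$T=\frac{\sum_{i=1}^I\mathrm{sgn}(Y_i)\,q_i}{\sum_{i=1}^I q_i}\in[0,1].$$ Bounding variable. For $\Gamma>0$, conditionally on the data (in particular with the scores $q_1,\dotsc,q_I$ held fixed), let $B_1,\dotsc,B_I$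 be independent Bernoulli variables with $\mathrm{P}(B_i=1)=\Gamma/(1+\Gamma)$, and set $$\overline{T}_\Gamma=\frac{\sum_{i=1}^I q_iB_i}{\sum_{i=1}^I q_i}.$$ The $p$-value upper bound is $\overline{p}_\Gamma=\mathrm{P}(\overline{T}_\Gamma\ge t\mid q_1,\dotsc,q_I)$ evaluated at $t=T$, the observed value of the statistic (the probability being over the $B_i$ only). Sensitivity value. For $0<\alpha<1$, the (untruncated) sensitivity value is $$\Gamma_\alpha^*=\inf\{\Gamma>0:\ \overline{p}_\Gamma\ge\alpha\},$$ and the transformed sensitivity value is $\kappa_\alpha^*=\Gamma_\alpha^*/(1+\Gamma_\alpha^* )$. Both are deterministic functions of the data from the first $I$ pairs. *)

(* Defs.v *)
From HB Require Import structures.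
From mathcomp Require Import all_boot all_order all_algebra.
From mathcomp Require Import all_classical all_reals all_analysis.
Set Implicit Arguments.
Unset Strict Implicit.
Unset Printing Implicit Defensive.
Import Order.TTheory GRing.Theory Num.Theory.
Import numFieldNormedType.Exports.
Local Open Scope classical_set_scope.
Local Open Scope ring_scope.

Section convergence_in_distribution.
Context {R : realType}.

(* [x] is a continuity point of the limit CDF exactly when [mu [set x] = 0]. *)
Definition cvg_law (L : nat -> set R -> \bar R) (mu : probability (measurableTypeR R) R) : Prop :=
  forall x : R, mu [set x] = 0%E ->
    L n `]-oo, x]%classic @[n --> \oo] --> mu `]-oo, x]%classic.

(* The [X n] are required to be random variables, since [P] is only meaningful
   on measurable events. *)
Definition cvg_in_distribution d (Om : measurableType d) (P : probability Om R)
    (X : nat -> Om -> R) (mu : probability (measurableTypeR R) R) : Prop :=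
  (forall n, measurable_fun [set: Om] (X n)) /\
  cvg_law (fun n A => P (X n @^-1` A)) mu.

End convergence_in_distribution.

Section normal_quantile.
Context {R : realType}.

Definition Phi (y : R) : R := fine (normal_prob (0 : R) 1 `]-oo, y]%classic).

Definition Phibar (y : R) : R := 1 - Phi y.

Definition Phibar_inv (a : R) : R := [get y : R | Phibar y = a].

End normal_quantile.

Section sampling.
Context {R : realType} {d : measure_display} {Om : measurableType d}.
Variable P : probability Om R.

(* Independence of every finite subfamily is the case where some of the [A i]
   are [setT]. *)
Definition iid d' (V : measurableType d') (X : nat -> Om -> V)
    (F : probability V R) : Prop :=
  [/\ forall i, measurable_fun [set: Om] (X i),
      forall i (A : set V), measurable A -> P (X i @^-1` A) = F A &
      forall n (A : nat -> set V), (forall i, measurable (A i)) ->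
        P (\bigcap_(i < n) (X i @^-1` A i)) =
        (\prod_(i < n) P (X i @^-1` A i))%E].

(* Conditionally on the sigma-algebra generated by all the subjects' baseline
   variables [W i j], the indicators [Z i ord0] are independent fair coins: for
   every event [B] of that sigma-algebra, the joint conditional probability
   2^-n of each assignment pattern integrates over [B] to [P B * 2^-n]. *)
Definition randomly_assigned d' (V : measurableType d')
    (Z : nat -> 'I_2 -> Om -> bool) (W : nat -> 'I_2 -> Om -> V) : Prop :=
  forall B : set Om,
    <<s \bigcup_i \bigcup_j preimage_set_system [set: Om] (W i j) measurable >> B ->
  forall n (z : nat -> bool),
    P (B `&` \bigcap_(i < n) [set w | Z i ord0 w = z i]) =
    (P B * ((2^-1 : R) ^+ n)%:E)%E.

End sampling.

Section matched_pairs.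
Context {R : realType} {Om : Type}.
Variables (Z : nat -> 'I_2 -> Om -> bool) (rT rC : nat -> 'I_2 -> Om -> R).

Definition outcome (i : nat) (j : 'I_2) (w : Om) : R :=
  (Z i j w)%:R * rT i j w + (1 - (Z i j w)%:R) * rC i j w.

Definition pair_data (i : nat) (w : Om) : (bool * bool) * (R * R) :=
  ((Z i ord0 w, Z i ord_max w), (outcome i ord0 w, outcome i ord_max w)).

Definition pair_diff (i : nat) (w : Om) : R :=
  ((Z i ord0 w)%:R - (Z i ord_max w)%:R)
  * (outcome i ord0 w - outcome i ord_max w).

Definition diffs (n : nat) (w : Om) : n.-tuple R :=
  [tuple pair_diff i w | i < n].

End matched_pairs.

Section scores.
Context {R : realType}.

(* For [n] pairs, [q n] maps the absolute differences to the scores. *)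
Definition score_function (q : forall n, n.-tuple R -> n.-tuple R) : Prop :=
  (forall n, measurable_fun [set: n.-tuple R] (q n)) /\
  forall n (a : n.-tuple R), (forall i, 0 <= tnth a i) ->
    forall i, 0 <= tnth (q n a) i /\ (tnth a i = 0 -> tnth (q n a) i = 0).

Definition scores (q : forall n, n.-tuple R -> n.-tuple R) n
    (y : n.-tuple R) : n.-tuple R :=
  q n [tuple `|tnth y i| | i < n].

End scores.

Section sensitivity.
Context {R : realType} {n : nat}.
Implicit Types (y s : n.-tuple R) (Gam t alpha : R) (b : n.-tuple bool).

(* When it vanishes, the quotients below are 0 by the convention x / 0 = 0. *)
Definition score_sum s : R := \sum_(i < n) tnth s i.

Definition signed_score y s : R :=
  (\sum_(i < n) (0 < tnth y i)%R%:R * tnth s i) / score_sum s.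

Definition score_sigma2 s : R :=
  (n%:R^-1 * \sum_(i < n) tnth s i ^+ 2)
  / (n%:R^-1 * \sum_(i < n) tnth s i) ^+ 2.

(* Joint law of [n] independent Bernoulli(p) variables. *)
Definition bernoullis (p : R) (E : set (n.-tuple bool)) : R :=
  \sum_(b : n.-tuple bool | b \in E) \prod_(i < n) bernoulli_pmf p (tnth b i).

Definition odds_prob Gam : R := Gam / (1 + Gam).

Definition bounding_stat s b : R :=
  (\sum_(i < n) tnth s i * (tnth b i)%:R) / score_sum s.

Definition std_bounding_stat Gam s b : R :=
  Num.sqrt n%:R * ((bounding_stat s b - odds_prob Gam)
                   / Num.sqrt (Gam / (1 + Gam) ^+ 2 * score_sigma2 s)).

(* Conditional law, given the scores [s]. *)
Definition std_bounding_law Gam s : set R -> \bar R :=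
  fun A => (bernoullis (odds_prob Gam) (std_bounding_stat Gam s @^-1` A))%:E.

Definition pvalue_bound Gam s t : R :=
  bernoullis (odds_prob Gam) [set b | t <= bounding_stat s b].

Definition sensitivity_value alpha y s : R :=
  inf [set Gam : R | 0 < Gam /\ alpha <= pvalue_bound Gam s (signed_score y s)].

Definition transformed_sensitivity_value alpha y s : R :=
  odds_prob (sensitivity_value alpha y s).

End sensitivity.

(* Main.v *)
Require Import Defs.
From HB Require Import structures.
From mathcomp Require Import all_boot all_order all_algebra.
From mathcomp Require Import all_classical all_reals all_analysis.
From mathcomp Require Import measurable_realfun ring lra.
Set Implicit Arguments.
Unset Strict Implicit.
Unset Printing Implicit Defensive.
Import Order.TTheory GRing.Theory Num.Theory.
Import numFieldNormedType.Exports.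
Local Open Scope classical_set_scope.
Local Open Scope ring_scope.

(* The bound on the p-value is nondecreasing in Gamma, so with
   k_n = mu_F + x / sqrt n, the event sqrt n (kappa* - mu_F) <= x is up to
   boundary effects the event that the p-value bound at Gamma = k_n / (1 - k_n)
   is at least alpha.  Here Gamma depends on n, whereas the central limit
   theorem is assumed only for fixed Gamma.  It is transferred from
   mu_F / (1 - mu_F) by coupling the Bernoulli(mu_F) and Bernoulli(k_n)
   variables: the standardized centred sums then differ by a variable whose
   second moment is at most |k_n - mu_F| / (mu_F (1 - mu_F)), whatever the
   scores.  Hence, for almost every realization and n large, the event reads
   sqrt n (T - mu_F) <= x + sigma_q Phibar^-1(alpha) sqrt (mu_F (1 - mu_F)) up
   to an arbitrarily small error, and the limit law of T concludes.  That
   0 < mu_F < 1 is forced by 0 <= T <= 1 and the normal limit. *)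

(** * Products of finite distributions and the Bernoulli coupling *)

Section finite_product.
Context {R : realType} {T : finType} {n : nat}.
Implicit Types (w g : T -> R) (c : n.-tuple T).

Lemma sum_tuple_prod (f : 'I_n -> T -> R) :
  \sum_(c : n.-tuple T) \prod_(i < n) f i (tnth c i) = \prod_(i < n) \sum_t f i t.
Proof.
rewrite bigA_distr_bigA /=.
rewrite (reindex (fun h : {ffun 'I_n -> T} => [tuple h i | i < n])) /=.
  by apply: eq_bigr => h _; apply: eq_bigr => i _; rewrite tnth_mktuple.
exists (fun c => [ffun i => tnth c i]) => [h _|c _].
  by apply/ffunP => i; rewrite ffunE tnth_mktuple.
by apply/eq_from_tnth => i; rewrite tnth_mktuple ffunE.
Qed.

(** The coordinatewise image of a product weight is the product of the image weights: tuples are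
    grouped by their image, and each fibre is a product of fibres. This recovers the two Bernoulli
    marginals from the coupling. *)
Lemma sum_tuple_map (T' : finType) w (h : T -> T') (phi : n.-tuple T' -> R) :
  \sum_(c : n.-tuple T) (\prod_(i < n) w (tnth c i)) * phi (map_tuple h c) =
  \sum_(b : n.-tuple T')
    (\prod_(i < n) \sum_(t | h t == tnth b i) w t) * phi b.
Proof.
rewrite (partition_big (fun c : n.-tuple T => map_tuple h c) xpredT) //=.
apply: eq_bigr => b _.
under eq_bigr => c /eqP -> do [].
rewrite -big_distrl /=; congr (_ * _).
under [RHS]eq_bigr => i _ do rewrite big_mkcond.
rewrite -sum_tuple_prod big_mkcond /=; apply: eq_bigr => c _.
case: ifPn => [/eqP <-|neq].
  by apply: eq_bigr => i _; rewrite tnth_map eqxx.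
suff [i hi] : exists i, h (tnth c i) != tnth b i.
  by apply/esym/eqP/prodf_eq0; exists i => //; rewrite (negbTE hi).
apply/existsP; rewrite -negb_forall; apply: contra neq => /forallP e.
by apply/eqP/eq_from_tnth => i; rewrite tnth_map; exact/eqP.
Qed.

(** Variance of a weighted sum of independent centred variables: after expanding the square, every
    off-diagonal term contains a factor equal to the mean of [g], which is zero. *)
Lemma sum_tuple_sqr w g (a : 'I_n -> R) :
  \sum_t w t = 1 -> \sum_t w t * g t = 0 ->
  \sum_(c : n.-tuple T)
     (\prod_(i < n) w (tnth c i)) * (\sum_(i < n) a i * g (tnth c i)) ^+ 2 =
  (\sum_(i < n) a i ^+ 2) * \sum_t w t * g t ^+ 2.
Proof.
move=> w1 wg0.
(* The exponent [(k == i) + (k == j)] is 0, 1 or 2 and treats [i = j] and [i != j] at once, so that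
   the expectation factors over the coordinates in both cases. *)
have cov i j : \sum_(c : n.-tuple T) (\prod_(k < n) w (tnth c k)) *
     (g (tnth c i) * g (tnth c j)) =
     \prod_(k < n) \sum_t w t * g t ^+ ((k == i) + (k == j)).
  rewrite -sum_tuple_prod; apply: eq_bigr => c _.
  rewrite big_split /=; congr (_ * _).
  under eq_bigr => k _ do rewrite exprD.
  have pick l : \prod_(k < n) g (tnth c k) ^+ (k == l) = g (tnth c l).
    rewrite (bigD1 l) //= eqxx expr1 big1 ?mulr1 // => k /negbTE ->.
    by rewrite expr0.
  by rewrite big_split /= !pick.
transitivity (\sum_(i < n) \sum_(j < n) a i * a j *
   \prod_(k < n) \sum_t w t * g t ^+ ((k == i) + (k == j))).
  under eq_bigr => c _ do
    rewrite expr2 big_distrlr /= big_distrr /=.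
  rewrite exchange_big /=; apply: eq_bigr => i _.
  under eq_bigr => c _ do rewrite big_distrr /=.
  rewrite exchange_big /=; apply: eq_bigr => j _.
  rewrite -cov big_distrr /=; apply: eq_bigr => c _.
  by ring.
rewrite big_distrl /=; apply: eq_bigr => i _.
rewrite (bigD1 i) //= [X in _ + X]big1 => [|j ji].
  rewrite addr0 -expr2; congr (_ * _).
  rewrite (bigD1 i) //= eqxx [X in _ * X]big1 ?mulr1 // => k /negbTE ->.
  by under eq_bigr => t _ do rewrite expr0 mulr1.
rewrite (bigD1 i) //= eqxx eq_sym (negbTE ji).
by under eq_bigr => t _ do rewrite expr1; rewrite wg0 mul0r mulr0.
Qed.

End finite_product.

Section bernoulli_coupling.
Context {R : realType}.
Implicit Types (p : R).

(** Joint law of the indicators of [U <= p] and [U <= p'] for one uniform [U]: the monotone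
    coupling, under which the two variables disagree with probability [|p' - p|] only. *)
Definition coupling_mass p p' (t : bool * bool) : R :=
  match t with
  | (true, true) => Num.min p p'
  | (true, false) => p - Num.min p p'
  | (false, true) => p' - Num.min p p'
  | (false, false) => 1 - Num.max p p'
  end.

Lemma sum_bool_pair (f : bool * bool -> R) :
  \sum_t f t = f (true, true) + f (true, false) + f (false, true) + f (false, false).
Proof.
transitivity (\sum_a \sum_b f (a, b)).
  by rewrite pair_bigA; apply: eq_bigr => -[].
by rewrite !big_bool /=; ring.
Qed.

Lemma coupling_mass_ge0 p p' t : 0 <= p <= 1 -> 0 <= p' <= 1 ->
  0 <= coupling_mass p p' t.
Proof.
move=> p01 p'01; case: t => -[] [] /=; case: (leP p p') => ?; lra.
Qed.

Lemma coupling_mass_fst p p' b :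
  \sum_(t | t.1 == b) coupling_mass p p' t = bernoulli_pmf p b.
Proof.
rewrite big_mkcond sum_bool_pair /bernoulli_pmf.
by case: b => /=; case: (leP p p') => ?; ring.
Qed.

Lemma coupling_mass_snd p p' b :
  \sum_(t | t.2 == b) coupling_mass p p' t = bernoulli_pmf p' b.
Proof.
rewrite big_mkcond sum_bool_pair /bernoulli_pmf.
by case: b => /=; case: (leP p p') => ?; ring.
Qed.

Variable n : nat.

Lemma bernoullisE p (E : set (n.-tuple bool)) :
  bernoullis p E =
  \sum_(b : n.-tuple bool) (\prod_(i < n) bernoulli_pmf p (tnth b i)) * (b \in E)%:R.
Proof.
rewrite /bernoullis big_mkcond; apply: eq_bigr => b _.
by case: (b \in E); rewrite ?mulr1 ?mulr0.
Qed.

Lemma bernoullis_fst p p' (E : set (n.-tuple bool)) :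
  bernoullis p E = \sum_(c : n.-tuple (bool * bool))
    (\prod_(i < n) coupling_mass p p' (tnth c i)) * (map_tuple fst c \in E)%:R.
Proof.
rewrite bernoullisE (sum_tuple_map _ _ (fun b => (b \in E)%:R)).
apply: eq_bigr => b _; congr (_ * _); apply: eq_bigr => i _.
exact/esym/coupling_mass_fst.
Qed.

Lemma bernoullis_snd p p' (E : set (n.-tuple bool)) :
  bernoullis p' E = \sum_(c : n.-tuple (bool * bool))
    (\prod_(i < n) coupling_mass p p' (tnth c i)) * (map_tuple snd c \in E)%:R.
Proof.
rewrite bernoullisE (sum_tuple_map _ _ (fun b => (b \in E)%:R)).
apply: eq_bigr => b _; congr (_ * _); apply: eq_bigr => i _.
exact/esym/coupling_mass_snd.
Qed.

(** Since [p <= p'], the coupling gives no mass to [(true, false)]; every tuple of positive weight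
    therefore has its first component below its second, and the inequality holds term by term. *)
Lemma bernoullis_le p p' (E E' : set (n.-tuple bool)) :
  0 <= p -> p <= p' -> p' <= 1 ->
  (forall b b' : n.-tuple bool,
     (forall i, tnth b i ==> tnth b' i) -> E b -> E' b') ->
  bernoullis p E <= bernoullis p' E'.
Proof.
move=> p0 pp' p'1 EE'.
rewrite (bernoullis_fst p p') (bernoullis_snd p p').
apply: ler_sum => c _.
have w0 t : 0 <= coupling_mass p p' t by apply: coupling_mass_ge0; lra.
have [/existsP[i ci]|] :=
    boolP [exists i, (tnth c i).1 && ~~ (tnth c i).2].
  suff -> : \prod_(i < n) coupling_mass p p' (tnth c i) = 0 by rewrite !mul0r.
  apply/eqP/prodf_eq0; exists i => //.
  by case: (tnth c i) ci => -[] [] //= _; rewrite min_l // subrr.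
rewrite negb_exists => /forallP cle.
apply: ler_wpM2l; first exact: prodr_ge0.
rewrite ler_nat; case: (boolP (_ \in E)) => // /set_mem cE.
rewrite mem_set //; apply: EE' cE => i; rewrite !tnth_map.
by have := cle i; case: (tnth c i) => -[] [].
Qed.

(* Under the coupling the two centred sums differ by a centred sum whose
   variance is at most [`|p' - p| * \sum_i s i ^+ 2]; conclude by Chebyshev. *)
Lemma bernoullis_sum_ge_le (s : 'I_n -> R) p p' (c dl : R) :
  0 <= p <= 1 -> 0 <= p' <= 1 -> 0 < dl ->
  bernoullis p' [set b : n.-tuple bool | c <= \sum_(i < n) s i * ((tnth b i)%:R - p')] <=
  bernoullis p [set b : n.-tuple bool | c - dl <= \sum_(i < n) s i * ((tnth b i)%:R - p)]
  + `|p' - p| * (\sum_(i < n) s i ^+ 2) / dl ^+ 2.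
Proof.
move=> p01 p'01 dl0.
pose w := coupling_mass p p'.
pose g (t : bool * bool) : R := (t.2%:R - p') - (t.1%:R - p).
have w0 t : 0 <= w t by exact: coupling_mass_ge0.
have w1 : \sum_t w t = 1.
  by rewrite sum_bool_pair /w /=; case: (leP p p') => ?; ring.
have wg0 : \sum_t w t * g t = 0.
  by rewrite sum_bool_pair /w /g /=; case: (leP p p') => ?; ring.
(* The exact variance of the difference of the coupled centred variables is
   [|p' - p| - (p' - p) ^+ 2]. *)
have wg2 : \sum_t w t * g t ^+ 2 <= `|p' - p|.
  have := sqr_ge0 (p' - p).
  rewrite sum_bool_pair /w /g /=; case: (leP p p') => pp' h.
    rewrite ger0_norm; last by rewrite subr_ge0.
    suff -> : p * (1 - p' - (1 - p)) ^+ 2 + (p - p) * (0 - p' - (1 - p)) ^+ 2 +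
      (p' - p) * (1 - p' - (0 - p)) ^+ 2 + (1 - p') * (0 - p' - (0 - p)) ^+ 2
      = (p' - p) - (p' - p) ^+ 2 by lra.
    ring.
  rewrite ltr0_norm; last by rewrite subr_lt0.
  suff -> : p' * (1 - p' - (1 - p)) ^+ 2 + (p - p') * (0 - p' - (1 - p)) ^+ 2 +
      (p' - p') * (1 - p' - (0 - p)) ^+ 2 + (1 - p) * (0 - p' - (0 - p)) ^+ 2
      = (p - p') - (p' - p) ^+ 2 by lra.
  ring.
have dl2 : 0 < dl ^+ 2 by rewrite exprn_gt0.
(* With the exact second moment in place of its bound, all three terms become averages over the same
   coupling and can be compared tuple by tuple. *)
apply: (@le_trans _ _ (bernoullis p
    [set b : n.-tuple bool | c - dl <= \sum_(i < n) s i * ((tnth b i)%:R - p)] +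
  (\sum_(i < n) s i ^+ 2) * (\sum_t w t * g t ^+ 2) / dl ^+ 2)); last first.
  rewrite lerD2l ler_pM2r ?invr_gt0 // mulrC ler_wpM2r //.
  by apply: sumr_ge0 => i _; exact: sqr_ge0.
rewrite -(@sum_tuple_sqr _ _ _ w g s w1 wg0).
rewrite (bernoullis_snd p p') (bernoullis_fst p p') -/w.
rewrite big_distrl -big_split /=; apply: ler_sum => a _.
rewrite -mulrA -mulrDr; apply: ler_wpM2l; first exact: prodr_ge0.
set D := \sum_(i < n) s i * g _.
have DE : D = \sum_(i < n) s i * ((tnth (map_tuple snd a) i)%:R - p')
    - \sum_(i < n) s i * ((tnth (map_tuple fst a) i)%:R - p).
  rewrite -sumrB; apply: eq_bigr => i _; rewrite !tnth_map /g; ring.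
have D0 : 0 <= D ^+ 2 / dl ^+ 2 by rewrite divr_ge0 ?sqr_ge0 // ltW.
(* Pointwise form of Chebyshev: if the event for [p'] occurs and the one for [p] fails, then
   [D > dl], so the last term is at least 1. *)
case: (boolP (_ \in _)) => [/set_mem /= h'|_]; last by rewrite addr_ge0.
case: (boolP (_ \in _)) => [_|/negP nh]; first by rewrite lerDl.
rewrite add0r ler_pdivlMr // mul1r.
have {}nh : ~ c - dl <= \sum_(i < n) s i * ((tnth (map_tuple fst a) i)%:R - p).
  by move=> h; apply: nh; rewrite mem_set.
rewrite -subr_ge0 subr_sqr mulr_ge0 //.
  by rewrite subr_ge0 DE; move/negP : nh; rewrite -ltNge => ?; lra.
by rewrite DE; move/negP : nh; rewrite -ltNge => ?; lra.
Qed.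

Lemma bernoullis_total p : bernoullis p (@setT (n.-tuple bool)) = 1.
Proof.
rewrite /bernoullis; under eq_bigl => b do rewrite in_setT.
rewrite (sum_tuple_prod (fun _ t => bernoulli_pmf p t)) big1 // => i _.
by rewrite big_bool /bernoulli_pmf /=; ring.
Qed.

Lemma bernoullisC p (E : set (n.-tuple bool)) :
  bernoullis p (~` E) = 1 - bernoullis p E.
Proof.
rewrite -(bernoullis_total p) !bernoullisE -sumrB.
apply: eq_bigr => b _; rewrite in_setC in_setT mulr1.
by case: (b \in E) => /=; ring.
Qed.

End bernoulli_coupling.

(** * The standard normal distribution function *)

Section normal_cdf.
Context {R : realType}.
Implicit Types m s a b x y : R.

Lemma normal_prob_set1 m s x : normal_prob m s [set x] = 0%E.
Proof.
have /null_content_dominatesP := normal_prob_dominates m s.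
by apply => //; exact: lebesgue_measure_set1.
Qed.

Lemma normal_probNy m s x : 0 < s ->
  normal_prob m s `]-oo, x]%classic = (Phi ((x - m) / s))%:E.
Proof.
move=> s0; have sn0 : s != 0 by rewrite gt_eqF.
have si0 : 0 < s^-1 by rewrite invr_gt0.
rewrite /Phi fineK; last exact: fin_num_measure.
pose h (y : R) : R := (y - m) / s.
have hd y : is_derive y 1 h s^-1.
  by rewrite /h; apply: is_derive_eq; rewrite scaler0 add0r subr0 [_ *: _]mulr1.
have hE : h^`()%classic = cst s^-1.
  by apply/funext => y; rewrite derive1E; have [_ ->] := hd y.
have hder y : derivable h y 1 by have [] := hd y.
rewrite /normal_prob -[(x - m) / s]/(h x).
rewrite [RHS](@increasing_ge0_integration_by_substitutionNy _ h (normal_pdf 0 1) x).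
- apply: eq_integral => y _; congr EFin.
  rewrite hE !fctE /= !normal_pdfE ?oner_neq0 // /normal_peak /normal_fun /h.
  have -> : Num.sqrt (s ^+ 2 * pi *+ 2) = s * Num.sqrt (1 ^+ 2 * pi *+ 2).
    by rewrite expr1n mul1r -mulrnAr sqrtrM ?sqr_ge0 // sqrtr_sqr gtr0_norm.
  have -> : - ((y - m) / s - 0) ^+ 2 / (1 ^+ 2 *+ 2) =
            - (y - m) ^+ 2 / (s ^+ 2 *+ 2) by field.
  by rewrite invfM; ring.
- by move=> a b _ _ ab; rewrite ltr_pM2r // ltrD2r.
- by rewrite hE => y _; exact: cst_continuous.
- by rewrite hE; exact: is_cvg_cst.
- by rewrite hE; exact: cvg_cst.
- split; first by [].
  apply: cvg_at_left_filter; apply/differentiable_continuous/derivable1_diffP.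
  exact: hder.
- rewrite /h; apply/gt0_cvgMlNy; first by [].
  exact: cvg_addrr_Ny.
- apply: continuous_subspaceT => y; apply: continuous_normal_pdf; exact: oner_neq0.
- by move=> y _; exact: normal_pdf_ge0.
Qed.

Lemma Phi_diff a b : a <= b ->
  (Phi b - Phi a)%:E = normal_prob 0 1 `]a, b]%classic.
Proof.
move=> ab; rewrite EFinB /Phi !fineK; try exact: fin_num_measure.
have -> : `]-oo, b]%classic = `]-oo, a]%classic `|` `]a, b]%classic :> set R.
  by rewrite -itv_bndbnd_setU // bnd_simp.
rewrite measureU //; last first.
  apply/seteqP; split => // y [] /=; rewrite !in_itv /= => ya /andP[ay _].
  by move: (lt_le_trans ay ya); rewrite ltxx.
by rewrite addeAC subee ?add0e //; exact: fin_num_measure.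
Qed.

Lemma Phi_nondecreasing : {homo (@Phi R) : a b / a <= b}.
Proof.
by move=> a b ab; rewrite -subr_ge0 -lee_fin Phi_diff.
Qed.

(** The density never exceeds its peak. The resulting Lipschitz bound is what gives the continuity
    of [Phi]. *)
Lemma Phi_diff_le a b : a <= b -> Phi b - Phi a <= normal_peak 1 * (b - a).
Proof.
move=> ab; rewrite -lee_fin Phi_diff // /normal_prob.
apply: (@le_trans _ _ (\int[lebesgue_measure]_(x in `]a, b]) (normal_peak (1 : R))%:E)%E).
  apply: ge0_le_integral => //=.
  - by move=> y _; rewrite lee_fin normal_pdf_ge0.
  - by apply/measurable_EFinP; apply: measurable_funTS; exact: measurable_normal_pdf.
  - by move=> y _; rewrite lee_fin normal_pdf_ub ?oner_neq0.
rewrite integral_cst //= lebesgue_measure_itv /= lte_fin.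
case: ltP => [_|ba]; first by rewrite -EFinB -EFinM.
by rewrite mule0 lee_fin mulr_ge0 ?normal_peak_ge0 // subr_ge0.
Qed.

Lemma Phi_lt : {homo (@Phi R) : a b / a < b}.
Proof.
move=> a b ab; rewrite -subr_gt0 -lte_fin Phi_diff ?(ltW ab) // /normal_prob.
(* A positive lower bound for the density on []a, b]], because [y ^+ 2 <= a ^+ 2 + b ^+ 2] there
   whatever the signs. *)
pose c : R := normal_peak 1 * expR (- (a ^+ 2 + b ^+ 2) / 2).
have c0 : 0 < c by rewrite mulr_gt0 ?normal_peak_gt0 ?oner_neq0 ?expR_gt0.
apply: (@lt_le_trans _ _ (\int[lebesgue_measure]_(x in `]a, b]) c%:E)%E).
  rewrite integral_cst //= lebesgue_measure_itv /= lte_fin ab.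
  by rewrite -EFinB -EFinM lte_fin mulr_gt0 // subr_gt0.
apply: ge0_le_integral => //=.
- by move=> y _; rewrite lee_fin ltW.
- by apply/measurable_EFinP; apply: measurable_funTS; exact: measurable_normal_pdf.
- move=> y; rewrite in_itv /= => /andP[ay yb].
  rewrite lee_fin normal_pdfE ?oner_neq0 // ler_pM2l; last first.
    by rewrite normal_peak_gt0 ?oner_neq0.
  rewrite ler_expR expr1n subr0 ler_pM2r ?invr_gt0 // lerN2.
  by have [y0|y0] := leP 0 y; nra.
Qed.

Lemma continuous_Phi : continuous (@Phi R).
Proof.
move=> x; apply/cvgrPdist_le => e e0.
have peak0 : 0 < normal_peak (1 : R) by rewrite normal_peak_gt0 ?oner_neq0.
near=> y.
have d : `|x - y| <= e / normal_peak 1.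
  by near: y; apply: cvgr_dist_le => //; rewrite divr_gt0.
have {}d : normal_peak 1 * `|x - y| <= e by rewrite mulrC -ler_pdivlMr.
apply: le_trans d; case: (leP x y) => [xy|/ltW xy].
  rewrite distrC [X in _ <= _ * X]distrC.
  by rewrite !ger0_norm ?subr_ge0 ?Phi_nondecreasing //; exact: Phi_diff_le.
by rewrite !ger0_norm ?subr_ge0 ?Phi_nondecreasing //; exact: Phi_diff_le.
Unshelve. all: by end_near. Qed.

(** The identity, seen as a random variable under the standard normal law, has [Phi] as its
    distribution function; the general limits of a cdf at both infinities then apply. *)
Let idR : measurableTypeR R -> R := idfun.

#[local] HB.instance Definition _ :=
  @isMeasurableFun.Build _ _ _ _ idR (@measurable_id _ _ setT).

Lemma cvg_Phiy : Phi x @[x --> +oo] --> (1 : R).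
Proof.
exact: (fine_cvg (cvg_cdfy1 (P := normal_prob 0 1) (idR : {RV _ >-> R}))).
Qed.

Lemma cvg_PhiNy : Phi x @[x --> -oo] --> (0 : R).
Proof.
exact: (fine_cvg (cvg_cdfNy0 (P := normal_prob 0 1) (idR : {RV _ >-> R}))).
Qed.

(** The choice operator in [Phibar_inv] is meaningful only if a solution exists; the intermediate
    value theorem provides one, from the limits 0 and 1 of [Phi]. *)
Lemma Phibar_invK a : 0 < a < 1 -> Phibar (Phibar_inv a) = a.
Proof.
move=> /andP[a0 a1]; suff [y ya] : exists y, Phibar y = a.
  by rewrite /Phibar_inv; exact: (xgetPex point (ex_intro (fun z => Phibar z = a) y ya)).
have [l hl] : exists l, Phi l < 1 - a.
  have h : 0 < 1 - a by rewrite subr_gt0.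
  exact: filter_ex (cvgr_lt _ cvg_PhiNy _ h).
have [r hr] : exists r, 1 - a < Phi r.
  have h : 1 - a < 1 by rewrite gtrBl.
  exact: filter_ex (cvgr_gt _ cvg_Phiy _ h).
have lr : l <= r.
  by rewrite leNgt; apply/negP => /ltW/Phi_nondecreasing; rewrite leNgt (lt_trans hl hr).
have [||y _ hy] := @IVT R Phi l r (1 - a) lr.
- exact/continuous_subspaceT/continuous_Phi.
- by rewrite ge_min le_max (ltW hl) (ltW hr) orbT.
- by exists y; rewrite /Phibar hy opprB addrC subrK.
Qed.

End normal_cdf.

(** * The sensitivity value at a fixed number of pairs *)

Section odds.
Context {R : realType}.
Implicit Types (Gam k : R).

Lemma odds_prob_ge0 Gam : 0 <= Gam -> 0 <= odds_prob Gam.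
Proof. by move=> g0; rewrite divr_ge0 // addr_ge0. Qed.

Lemma odds_prob_lt1 Gam : 0 <= Gam -> odds_prob Gam < 1.
Proof. by move=> g0; rewrite ltr_pdivrMr ?mul1r ?ltrDr // ltr_wpDr. Qed.

Lemma odds_prob_le Gam Gam' : 0 <= Gam -> Gam <= Gam' ->
  odds_prob Gam <= odds_prob Gam'.
Proof.
move=> g0 gg'; rewrite /odds_prob ler_pdivrMr ?ltr_wpDr // mulrAC ler_pdivlMr; first nra.
by rewrite ltr_wpDr // (le_trans g0 gg').
Qed.

(** Inverse of [odds_prob]: the odds [Gamma] at which the bounding Bernoulli variables have success
    probability [k]. *)
Definition odds_of k : R := k / (1 - k).

Lemma odds_ofK k : k < 1 -> odds_prob (odds_of k) = k.
Proof.
move=> k1; have ? : 1 - k != 0 by rewrite gt_eqF // subr_gt0.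
have e : 1 + k / (1 - k) = (1 - k)^-1 by field.
by rewrite /odds_prob /odds_of e invrK divfK.
Qed.

Lemma odds_of_gt0 k : 0 < k < 1 -> 0 < odds_of k.
Proof. by move=> /andP[? ?]; rewrite divr_gt0 // subr_gt0. Qed.

End odds.

Section sensitivity_value.
Context {R : realType} {n : nat}.
Implicit Types (y s : n.-tuple R) (Gam t k alpha : R).

Lemma signed_score_itv y s : (forall i, 0 <= tnth s i) ->
  0 <= signed_score y s <= 1.
Proof.
move=> s0; rewrite /signed_score.
set N := \sum_(i < n) _.
have N0 : 0 <= N by apply: sumr_ge0 => i _; rewrite mulr_ge0.
have NS : N <= score_sum s.
  by apply: ler_sum => i _; rewrite ler_piMl // lern1 leq_b1.
have S0 : 0 <= score_sum s by exact: le_trans NS.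
rewrite divr_ge0 //=; have [Sp|] := ltP 0 (score_sum s).
  by rewrite ler_pdivrMr // mul1r.
(* When all scores vanish the quotient is 0 by the convention on division, so the bounds persist. *)
by move=> S0'; rewrite (@le_anti _ _ (score_sum s) 0) ?S0 ?S0' // invr0 mulr0.
Qed.

Lemma pvalue_bound_le s t Gam Gam' : (forall i, 0 <= tnth s i) ->
  0 <= Gam -> Gam <= Gam' -> pvalue_bound Gam s t <= pvalue_bound Gam' s t.
Proof.
move=> s0 g0 gg'; have g'0 := le_trans g0 gg'.
apply: bernoullis_le; [exact: odds_prob_ge0|exact: odds_prob_le|
  exact/ltW/odds_prob_lt1|].
move=> b b' bb' /= tb; apply: le_trans tb _.
have S0 : 0 <= score_sum s by exact: sumr_ge0.
rewrite ler_wpM2r ?invr_ge0 //; apply: ler_sum => i _.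
by rewrite ler_wpM2l // ler_nat; have := bb' i; case: (tnth b i); case: (tnth b' i).
Qed.

Lemma one_sub_mul_le_expr (e : R) m : 0 <= e <= 1 ->
  1 - m%:R * e <= (1 - e) ^+ m.
Proof.
move=> /andP[e0 e1]; elim: m => [|m IH]; first by rewrite mul0r subr0 expr0.
rewrite exprS; apply: (@le_trans _ _ ((1 - e) * (1 - m%:R * e))); last first.
  by rewrite ler_wpM2l // subr_ge0.
rewrite -natr1; have : 0 <= (m%:R : R) by []. nra.
Qed.

(** Makes the infimum defining the sensitivity value one of a nonempty set. At success probability
    [1 - e] the all-ones tuple alone has mass [(1 - e) ^+ n >= 1 - n e >= alpha], and it always lies
    in the event. *)
Lemma exists_pvalue_bound_ge y s alpha : (forall i, 0 <= tnth s i) ->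
  alpha < 1 ->
  exists Gam, 0 < Gam /\ alpha <= pvalue_bound Gam s (signed_score y s).
Proof.
move=> s0 a1.
(* The first bound keeps [1 - e] inside []0, 1[], the second gives [n e <= 1 - alpha]; [n.+1] avoids
   a division by zero at [n = 0]. *)
pose e : R := Num.min 2^-1 ((1 - alpha) / n.+1%:R).
have e0 : 0 < e by rewrite lt_min invr_gt0 ltr0n divr_gt0 ?subr_gt0.
have e1 : e <= 2^-1 by rewrite ge_min lexx.
have h2 : 2^-1 < (1 : R) by rewrite invf_lt1 // ltr1n.
have en : n%:R * e <= 1 - alpha.
  apply: (@le_trans _ _ (n.+1%:R * ((1 - alpha) / n.+1%:R))).
    by rewrite ler_pM // ?(ltW e0) ?ler_nat // ge_min lexx orbT.
  by rewrite mulrC divfK.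
have k01 : 0 < 1 - e < 1 by apply/andP; split; lra.
exists (odds_of (1 - e)); split; first exact: odds_of_gt0.
rewrite /pvalue_bound odds_ofK; last by case/andP: k01.
apply: (@le_trans _ _ ((1 - e) ^+ n)).
  have := @one_sub_mul_le_expr e n; lra.
rewrite bernoullisE (bigD1 [tuple true | i < n]) //=.
set A := \prod_(i < n) _; have -> : A = (1 - e) ^+ n.
  rewrite /A; under eq_bigr => i _ do rewrite tnth_mktuple.
  by rewrite prodr_const card_ord.
(* On the all-ones tuple the bounding statistic is 1, hence at least the signed score; if the scores
   sum to 0, both are 0. *)
rewrite mem_set; last first.
  rewrite /= /bounding_stat (eq_bigr (tnth s)); last first.
    by move=> i _; rewrite tnth_mktuple mulr1.
  rewrite -/(score_sum s); have [S0|S0] := eqVneq (score_sum s) 0.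
    by rewrite /signed_score S0 !invr0 !mulr0.
  by rewrite divff //; case/andP: (signed_score_itv y s0).
rewrite mulr1 lerDl; apply: sumr_ge0 => b _; rewrite mulr_ge0 //.
by apply: prodr_ge0 => i _; apply: bernoulli_pmf_ge0; lra.
Qed.

Lemma sensitivity_value_ge0 alpha y s : 0 <= sensitivity_value alpha y s.
Proof.
rewrite /sensitivity_value; set E := [set Gam | _].
have [E0|E0] := pselect (E !=set0); last by rewrite inf_out // => -[].
by apply: lb_le_inf => // g [/ltW].
Qed.

Lemma transformed_sensitivity_value_le alpha y s k : 0 < k < 1 ->
  alpha <= pvalue_bound (odds_of k) s (signed_score y s) ->
  transformed_sensitivity_value alpha y s <= k.
Proof.
move=> k01 ap; rewrite -(@odds_ofK _ k); last by case/andP: k01.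
apply: odds_prob_le; first exact: sensitivity_value_ge0.
apply: ge_inf; last by split; first exact: odds_of_gt0.
by exists 0 => g [/ltW].
Qed.

(** Strict inequality yields an element of the defining set below [odds_of k]; monotonicity of the
    p-value bound carries the property up to [odds_of k]. *)
Lemma transformed_sensitivity_value_lt alpha y s k :
  (forall i, 0 <= tnth s i) -> alpha < 1 -> 0 < k < 1 ->
  transformed_sensitivity_value alpha y s < k ->
  alpha <= pvalue_bound (odds_of k) s (signed_score y s).
Proof.
move=> s0 a1 k01 lek.
have [g [g0 ag] gk] : exists2 g,
    0 < g /\ alpha <= pvalue_bound g s (signed_score y s) & g < odds_of k.
  apply: inf_lt; first exact: exists_pvalue_bound_ge.
  rewrite ltNge; apply: contraL lek => kle; rewrite -leNgt.
  rewrite -{1}(@odds_ofK _ k); last by case/andP: k01.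
  by apply: odds_prob_le kle; exact/ltW/odds_of_gt0.
by apply: le_trans ag _; apply: pvalue_bound_le => //; exact: ltW.
Qed.

End sensitivity_value.

(** * Measurability of the statistic and of the sensitivity value *)

Section measurability.
Context {R : realType} {d : measure_display} {Om : measurableType d} {n : nat}.
Variables (y s : Om -> n.-tuple R).
Hypotheses (y_meas : measurable_fun [set: Om] y)
           (s_meas : measurable_fun [set: Om] s)
           (s_ge0 : forall w i, 0 <= tnth (s w) i).

Let tnth_meas (v : Om -> n.-tuple R) i : measurable_fun [set: Om] v ->
  measurable_fun [set: Om] (fun w => tnth (v w) i).
Proof. by move/measurable_fun_tnthP; apply. Qed.

Let sum_meas : measurable_fun [set: Om] (fun w => (score_sum (s w))^-1).
Proof.
apply: (eq_measurable_fun (fun w => score_sum (s w) `^ (-1))).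
  by move=> w _; rewrite powR_inv1 // sumr_ge0.
apply: (@measurableT_comp _ _ _ _ _ _ (@powR R ^~ (-1))) => //.
by apply: measurable_sum => i; exact: tnth_meas.
Qed.

Lemma measurable_signed_score :
  measurable_fun [set: Om] (fun w => signed_score (y w) (s w)).
Proof.
apply: measurable_funM => //; apply: measurable_sum => i.
apply: measurable_funM; last exact: tnth_meas.
apply: (@measurableT_comp _ _ _ _ _ _ (fun b : bool => b%:R : R)) => //.
by apply: measurable_fun_ltr => //; exact: tnth_meas.
Qed.

Lemma measurable_pvalue_bound Gam :
  measurable_fun [set: Om]
    (fun w => pvalue_bound Gam (s w) (signed_score (y w) (s w))).
Proof.
rewrite /pvalue_bound.
under eq_fun do rewrite bernoullisE.
apply: measurable_sum => b; apply: measurable_funM => //.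
apply: (@measurableT_comp _ _ _ _ _ _ (fun b : bool => b%:R : R)) => //.
rewrite [X in measurable_fun _ X](_ : _ = fun w =>
  signed_score (y w) (s w) <= bounding_stat (s w) b); last first.
  by apply/funext => w; apply/idP/idP => [/set_mem|h]; last exact/mem_set.
apply: measurable_fun_ler; first exact: measurable_signed_score.
apply: measurable_funM => //; apply: measurable_sum => i.
by apply: measurable_funM => //; exact: tnth_meas.
Qed.

Lemma measurable_transformed_sensitivity_value alpha : alpha < 1 ->
  measurable_fun [set: Om]
    (fun w => transformed_sensitivity_value alpha (y w) (s w)).
Proof.
move=> a1; apply: (measurability (@RGenInftyO.G R)); first exact: RGenInftyO.measurableE.
move=> _ [_ [c ->] <-]; rewrite setTI.
(* The infimum ranges over an uncountable set. By the two preceding comparison lemmas, being below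
   [c] means that the p-value bound reaches [alpha] at some rational [r < c] in []0, 1[], a
   countable union of measurable events. *)
rewrite [X in measurable X](_ : _ = \bigcup_(r : rat)
    (if (0 < (ratr r : R) < 1) && (ratr r < c)
     then [set w | alpha <= pvalue_bound (odds_of (ratr r)) (s w)
                      (signed_score (y w) (s w))] else set0)); last first.
  apply/seteqP; split => [w /=|w [r _] /=].
    rewrite in_itv /= => kc.
    have k0 : 0 <= transformed_sensitivity_value alpha (y w) (s w).
      exact/odds_prob_ge0/sensitivity_value_ge0.
    have kc1 : transformed_sensitivity_value alpha (y w) (s w) < Num.min c 1.
      by rewrite lt_min kc odds_prob_lt1 // sensitivity_value_ge0.
    have [r] := rat_in_itvoo kc1; rewrite in_itv /= lt_min => /and3P[kr rc r1].
    have r01 : 0 < (ratr r : R) < 1 by rewrite r1 andbT (le_lt_trans k0).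
    exists r => //=; rewrite r01 rc.
    exact: transformed_sensitivity_value_lt.
  case: ifP => // /andP[r01 rc] aw; rewrite in_itv /=; apply: le_lt_trans rc.
  exact: transformed_sensitivity_value_le.
apply: bigcupT_measurable_rat => r; case: ifP => // _.
rewrite -[X in measurable X]setTI.
have := measurable_fun_ler (measurable_cst alpha) (measurable_pvalue_bound (odds_of (ratr r))).
by move=> /(_ measurableT [set true]); apply.
Qed.

End measurability.

(** * Asymptotics for a fixed realization of the data *)

Section bounding_clt.
Context {R : realType}.
Implicit Types (k x y z e alpha : R).

Definition centred_sum n (s : n.-tuple R) k (b : n.-tuple bool) : R :=
  \sum_(i < n) tnth s i * ((tnth b i)%:R - k).

(** Euclidean norm of the scores: [Num.sqrt (k * (1 - k)) * score_norm s] is the standard deviation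
    of [centred_sum s k]. *)
Definition score_norm n (s : n.-tuple R) : R :=
  Num.sqrt (\sum_(i < n) tnth s i ^+ 2).

Lemma bernoullis_subset n k (E E' : set (n.-tuple bool)) :
  0 <= k <= 1 -> E `<=` E' -> bernoullis k E <= bernoullis k E'.
Proof.
move=> k01 EE'; rewrite !bernoullisE; apply: ler_sum => b _.
rewrite ler_wpM2l //.
  by apply: prodr_ge0 => i _; exact: bernoulli_pmf_ge0.
by rewrite ler_nat; case: (boolP (b \in E)) => // /set_mem/EE'/mem_set ->.
Qed.

Lemma sum_score_gt0 n (s : n.-tuple R) : 0 < score_sum s ->
  0 < \sum_(i < n) tnth s i ^+ 2.
Proof.
move=> S0; have A0 : 0 <= \sum_(i < n) tnth s i ^+ 2.
  by apply: sumr_ge0 => i _; exact: sqr_ge0.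
rewrite lt_neqAle A0 andbT eq_sym; apply: contraTneq S0 => /eqP.
rewrite psumr_eq0; last by move=> i _; exact: sqr_ge0.
move=> /allP h; rewrite /score_sum big1 ?ltxx // => i _.
by have := h i (mem_index_enum i); rewrite sqrf_eq0 => /eqP.
Qed.

Lemma score_norm_gt0 n (s : n.-tuple R) : 0 < score_sum s -> 0 < score_norm s.
Proof. by move=> S0; rewrite sqrtr_gt0 sum_score_gt0. Qed.

Lemma score_sum_gt0_size n (s : n.-tuple R) : 0 < score_sum s -> (0 < n)%N.
Proof. by case: n s => // s; rewrite /score_sum big_ord0 ltxx. Qed.

Lemma sqrt_score_sigma2 n (s : n.-tuple R) : 0 < score_sum s ->
  Num.sqrt (score_sigma2 s) = Num.sqrt n%:R * score_norm s / score_sum s.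
Proof.
move=> S0; have n0 := score_sum_gt0_size S0.
have n0' : (n%:R : R) != 0 by rewrite pnatr_eq0 -lt0n.
have S0' : score_sum s != 0 by rewrite gt_eqF.
have -> : score_sigma2 s =
    n%:R * (\sum_(i < n) tnth s i ^+ 2) * ((score_sum s)^-1) ^+ 2.
  by rewrite /score_sigma2 -/(score_sum s); field; rewrite n0' S0'.
rewrite sqrtrM; last first.
  by rewrite mulr_ge0 //; apply: sumr_ge0 => i _; exact: sqr_ge0.
by rewrite sqrtrM // sqrtr_sqr gtr0_norm // invr_gt0.
Qed.

Lemma bounding_stat_sub n (s : n.-tuple R) k b : score_sum s != 0 ->
  bounding_stat s b - k = centred_sum s k b / score_sum s.
Proof.
move=> S0; rewrite /bounding_stat /centred_sum.
under [in RHS]eq_bigr => i _ do rewrite mulrBr.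
by rewrite sumrB -big_distrl /= -/(score_sum s) mulrBl mulrAC divff // mul1r.
Qed.

Lemma std_bounding_statE n (s : n.-tuple R) k b : 0 < k < 1 ->
  0 < score_sum s ->
  std_bounding_stat (odds_of k) s b =
  centred_sum s k b / (Num.sqrt (k * (1 - k)) * score_norm s).
Proof.
move=> /andP[k0 k1] S0; have n0 := score_sum_gt0_size S0.
have S0' : score_sum s != 0 by rewrite gt_eqF.
have k1' : 1 - k != 0 by rewrite gt_eqF // subr_gt0.
have c0 : 0 < k * (1 - k) by rewrite mulr_gt0 // subr_gt0.
rewrite /std_bounding_stat odds_ofK // bounding_stat_sub //.
have -> : odds_of k / (1 + odds_of k) ^+ 2 = k * (1 - k).
  have e : 1 + odds_of k = (1 - k)^-1 by rewrite /odds_of; field.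
  by rewrite e /odds_of; field; rewrite k1'.
rewrite sqrtrM ?(ltW c0) // sqrt_score_sigma2 //.
have Q0 : score_norm s != 0 by rewrite gt_eqF // score_norm_gt0.
have c0' : Num.sqrt (k * (1 - k)) != 0 by rewrite gt_eqF // sqrtr_gt0.
have n0' : Num.sqrt (n%:R : R) != 0 by rewrite gt_eqF // sqrtr_gt0 ltr0n.
by field; rewrite n0' Q0 c0' S0'.
Qed.

Lemma pvalue_boundE n (s : n.-tuple R) k t : k < 1 -> 0 < score_sum s ->
  pvalue_bound (odds_of k) s t =
  bernoullis k [set b | (t - k) * score_sum s <= centred_sum s k b].
Proof.
move=> k1 S0; rewrite /pvalue_bound odds_ofK //; congr bernoullis.
by apply/seteqP; split => b /=;
  rewrite -(lerD2r (- k) t) bounding_stat_sub ?gt_eqF // ler_pdivlMr.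
Qed.

Lemma continuous_Phibar : continuous (@Phibar R).
Proof. by move=> y; apply: cvgB; [exact: cvg_cst|exact: continuous_Phi]. Qed.

(** Leaves room to move the threshold: one [dl] pays for the coupling, and on the left a second one
    for passing from a weak to a strict inequality. *)
Lemma near_shift (f : R -> Prop) y : (\forall z \near y, f z) ->
  exists2 dl, 0 < dl & f (y + dl) /\ f (y - dl - dl).
Proof.
move=> /nbhs_ballP[e /= e0 ye]; exists (e / 3); first by rewrite divr_gt0.
have e3 : e = 3 * (e / 3) by rewrite mulrC divfK.
have e3' : 0 < e / 3 by rewrite divr_gt0.
by split; apply: ye; rewrite /ball /= ltr_norml; apply/andP; split; lra.
Qed.

(** * Bernoulli tails when the success probability varies with [n] *)

Section fixed_scores.
Variables (S : forall n, n.-tuple R) (k0 : R) (k : nat -> R).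
Hypotheses (k01 : 0 < k0 < 1) (k_cvg : k n @[n --> \oo] --> k0)
  (S_pos : \forall n \near \oo, 0 < score_sum (S n))
  (clt : cvg_law (fun n => std_bounding_law (odds_of k0) (S n)) (normal_prob 0 1)).

Let sd : R := Num.sqrt (k0 * (1 - k0)).

Let sd_gt0 : 0 < sd.
Proof. by case/andP: k01 => ? ?; rewrite sqrtr_gt0 mulr_gt0 // subr_gt0. Qed.

(** The threshold is measured in standard deviations at [k0] for every success probability [p],
    which makes tails for different [p] comparable. *)
Let tail n p y := bernoullis p
  [set b | y * (sd * score_norm (S n)) <= centred_sum (S n) p b].

Let cdf0 n z := bernoullis k0
  [set b | centred_sum (S n) k0 b / (sd * score_norm (S n)) <= z].

Let cdf0_cvg z : cdf0 n z @[n --> \oo] --> Phi z.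
Proof.
have := clt (normal_prob_set1 0 1 z).
rewrite /= (normal_probNy 0 z ltr01) subr0 divr1.
move/fine_cvg; apply: cvg_trans; apply: near_eq_cvg.
near=> n; rewrite /= odds_ofK; last by case/andP: k01.
congr bernoullis; apply/seteqP; split => b /=; rewrite in_itv /= std_bounding_statE //;
  by near: n; exact: S_pos.
Unshelve. all: by end_near. Qed.

Let k_itv : \forall n \near \oo, 0 <= k n <= 1.
Proof.
case/andP: k01 => k0_gt0 k0_lt1.
near=> n; apply/andP; split; near: n.
  by apply: (cvgr_ge k0).
by apply: (cvgr_le k0).
Unshelve. all: by end_near. Qed.

Let defect_cvg dl : 0 < dl -> `|k n - k0| / (dl * sd) ^+ 2 @[n --> \oo] --> (0 : R).
Proof.
move=> dl0.
have : `|k n - k0| / (dl * sd) ^+ 2 @[n --> \oo] --> `|k0 - k0| / (dl * sd) ^+ 2.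
  by apply: cvgM; [apply: cvg_norm; apply: cvgB => //; exact: cvg_cst|exact: cvg_cst].
by rewrite subrr normr0 mul0r.
Qed.

(** The coupling bound with slack [dl] standard deviations: the sum of squared scores cancels, so
    the error is free of the scores and vanishes as the probabilities merge. *)
Let tail_compare n p p' y dl : 0 < score_sum (S n) -> 0 < dl ->
  0 <= p <= 1 -> 0 <= p' <= 1 ->
  tail n p' y <= tail n p (y - dl) + `|p' - p| / (dl * sd) ^+ 2.
Proof.
move=> S0 dl0 p01 p'01; have Q0 := score_norm_gt0 S0.
have d0 : 0 < dl * (sd * score_norm (S n)) by rewrite !mulr_gt0.
apply: le_trans (@bernoullis_sum_ge_le _ n (tnth (S n)) p p' _ _ p01 p'01 d0) _.
rewrite -mulrBl lerD2l.
have -> : \sum_(i < n) tnth (S n) i ^+ 2 = score_norm (S n) ^+ 2.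
  by rewrite sqr_sqrtr // ltW // sum_score_gt0.
suff -> : `|p' - p| * score_norm (S n) ^+ 2 / (dl * (sd * score_norm (S n))) ^+ 2 =
   `|p' - p| / (dl * sd) ^+ 2 by [].
by field; rewrite (gt_eqF Q0) (gt_eqF sd_gt0) (gt_eqF dl0).
Qed.

Let tail_ge n y : 0 < score_sum (S n) -> 1 - cdf0 n y <= tail n k0 y.
Proof.
move=> S0; have Q0 := score_norm_gt0 S0.
rewrite /cdf0 -bernoullisC; apply: bernoullis_subset.
  by case/andP: k01 => ? ?; rewrite !ltW.
by move=> b /= /negP; rewrite -ltNge ltr_pdivlMr ?mulr_gt0 // => /ltW.
Qed.

Let tail_le n y z : 0 < score_sum (S n) -> z < y -> tail n k0 y <= 1 - cdf0 n z.
Proof.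
move=> S0 zy; have Q0 := score_norm_gt0 S0.
rewrite /cdf0 -bernoullisC; apply: bernoullis_subset.
  by case/andP: k01 => ? ?; rewrite !ltW.
move=> b /= h; apply/negP; rewrite -ltNge ltr_pdivlMr ?mulr_gt0 //.
by apply: lt_le_trans h; rewrite ltr_pM2r // mulr_gt0.
Qed.

(** The tail at [k n] beyond [y] is at least the one at [k0] beyond [y + dl] minus the coupling
    error; the latter tail is controlled by the central limit theorem at [k0]. *)
Lemma tail_eventually_gt y alpha : alpha < Phibar y ->
  \forall n \near \oo, alpha < bernoullis (k n)
     [set b | y * (Num.sqrt (k0 * (1 - k0)) * score_norm (S n))
              <= centred_sum (S n) (k n) b].
Proof.
move=> ay.
have [dl dl0 ady] : exists2 dl, 0 < dl & alpha < Phibar (y + dl).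
  by have [dl dl0 []] := near_shift (cvgr_gt _ (@continuous_Phibar y) _ ay); exists dl.
have lim : (1 - cdf0 n (y + dl)) - `|k n - k0| / (dl * sd) ^+ 2 @[n --> \oo]
    --> Phibar (y + dl) - 0.
  by apply: cvgB; [apply: cvgB; [exact: cvg_cst|exact: cdf0_cvg]|exact: defect_cvg].
rewrite subr0 in lim.
near=> n.
have S0 : 0 < score_sum (S n) by near: n; exact: S_pos.
have kn : 0 <= k n <= 1 by near: n; exact: k_itv.
apply: (@lt_le_trans _ _ ((1 - cdf0 n (y + dl)) - `|k n - k0| / (dl * sd) ^+ 2)).
  by near: n; exact: (cvgr_gt _ lim).
rewrite lerBlDr; apply: (le_trans (tail_ge _ S0)).
have k0' : 0 <= k0 <= 1 by case/andP: k01 => ? ?; rewrite !ltW.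
by have := tail_compare (y + dl) S0 dl0 kn k0'; rewrite addrK distrC.
Unshelve. all: by end_near. Qed.

Lemma tail_eventually_lt y alpha : Phibar y < alpha ->
  \forall n \near \oo, bernoullis (k n)
     [set b | y * (Num.sqrt (k0 * (1 - k0)) * score_norm (S n))
              <= centred_sum (S n) (k n) b] < alpha.
Proof.
move=> ay.
have [dl dl0 ady] : exists2 dl, 0 < dl & Phibar (y - dl - dl) < alpha.
  by have [dl dl0 []] := near_shift (cvgr_lt _ (@continuous_Phibar y) _ ay); exists dl.
have lim : (1 - cdf0 n (y - dl - dl)) + `|k n - k0| / (dl * sd) ^+ 2 @[n --> \oo]
    --> Phibar (y - dl - dl) + 0.
  by apply: cvgD; [apply: cvgB; [exact: cvg_cst|exact: cdf0_cvg]|exact: defect_cvg].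
rewrite addr0 in lim.
near=> n.
have S0 : 0 < score_sum (S n) by near: n; exact: S_pos.
have kn : 0 <= k n <= 1 by near: n; exact: k_itv.
apply: (@le_lt_trans _ _ ((1 - cdf0 n (y - dl - dl)) + `|k n - k0| / (dl * sd) ^+ 2)); last first.
  by near: n; exact: (cvgr_lt _ lim).
have k0' : 0 <= k0 <= 1 by case/andP: k01 => ? ?; rewrite !ltW.
apply: le_trans (tail_compare y S0 dl0 k0' kn) _.
by rewrite lerD2r tail_le // ltrBlDr ltrDl.
Unshelve. all: by end_near. Qed.

End fixed_scores.
End bounding_clt.

(** * From the statistic to the sensitivity value, along one realization *)

Section sensitivity_asymptotics.
Context {R : realType}.
Variables (S Y : forall n, n.-tuple R) (k0 sigma2 alpha : R).
Hypotheses (k01 : 0 < k0 < 1) (alpha01 : 0 < alpha < 1)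
  (S_ge0 : forall n i, 0 <= tnth (S n) i)
  (S_pos : \forall n \near \oo, 0 < score_sum (S n))
  (sigma2_cvg : score_sigma2 (S n) @[n --> \oo] --> sigma2)
  (clt : cvg_law (fun n => std_bounding_law (odds_of k0) (S n)) (normal_prob 0 1)).

Let T n := signed_score (Y n) (S n).
Let kappa n := transformed_sensitivity_value alpha (Y n) (S n).
Let sd : R := Num.sqrt (k0 * (1 - k0)).
Let shift := Phibar_inv alpha * sd * Num.sqrt sigma2.

Let sd_gt0 : 0 < sd.
Proof. by case/andP: k01 => ? ?; rewrite sqrtr_gt0 mulr_gt0 // subr_gt0. Qed.

(** Candidate value for [kappa]: the event [kappa n <= k x n] is the rescaled event whose limiting
    probability is sought. *)
Let k (x : R) n := k0 + x / Num.sqrt n%:R.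

Let k_cvg x : k x n @[n --> \oo] --> k0.
Proof.
rewrite -[X in _ --> X]addr0; apply: cvgD; first exact: cvg_cst.
rewrite -[X in _ --> X](mulr0 x); apply: cvgM; first exact: cvg_cst.
have -> : (fun n => (Num.sqrt n%:R)^-1) = (fun n => Num.sqrt n%:R^-1) :> (nat -> R).
  by apply/funext => n; rewrite sqrtrV.
rewrite -sqrtr0; apply: continuous_cvg; first exact: sqrt_continuous.
apply/gtr0_cvgV0; last exact: cvgr_idn.
by near=> n; rewrite ltr0n; near: n; exact: nbhs_infty_gt.
Unshelve. all: by end_near. Qed.

Let k_itv x : \forall n \near \oo, 0 < k x n < 1.
Proof.
case/andP: k01 => k0_gt0 k0_lt1.
near=> n; apply/andP; split; near: n.
  exact: (cvgr_gt k0 (k_cvg x)).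
exact: (cvgr_lt k0 (k_cvg x)).
Unshelve. all: by end_near. Qed.

Let threshold_cvg (y : R) : y * sd * Num.sqrt (score_sigma2 (S n)) @[n --> \oo]
  --> y * sd * Num.sqrt sigma2.
Proof.
apply: cvgM; first exact: cvg_cst.
by apply: continuous_cvg => //; exact: sqrt_continuous.
Qed.

Let scaled_sub n x t : (0 < n)%N ->
  Num.sqrt n%:R * (t - k x n) = Num.sqrt n%:R * (t - k0) - x.
Proof.
move=> n0; have n0' : Num.sqrt (n%:R : R) != 0 by rewrite gt_eqF // sqrtr_gt0 ltr0n.
by rewrite /k; field.
Qed.

Let thresholdE n (y t x : R) : 0 < score_sum (S n) ->
  (Num.sqrt n%:R * (t - k0) - x <= y * sd * Num.sqrt (score_sigma2 (S n))) =
  ((t - k x n) * score_sum (S n) <= y * (sd * score_norm (S n))).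
Proof.
move=> S0; have n0 := score_sum_gt0_size S0.
rewrite -scaled_sub // sqrt_score_sigma2 //.
have -> : y * sd * (Num.sqrt n%:R * score_norm (S n) / score_sum (S n)) =
  Num.sqrt n%:R * (y * (sd * score_norm (S n))) / score_sum (S n) by ring.
rewrite ler_pdivlMr // -mulrA ler_pM2l //.
by rewrite sqrtr_gt0 ltr0n.
Qed.

Let thresholdE' n (y t x : R) : 0 < score_sum (S n) ->
  (y * sd * Num.sqrt (score_sigma2 (S n)) <= Num.sqrt n%:R * (t - k0) - x) =
  (y * (sd * score_norm (S n)) <= (t - k x n) * score_sum (S n)).
Proof.
move=> S0; have n0 := score_sum_gt0_size S0.
rewrite -scaled_sub // sqrt_score_sigma2 //.
have -> : y * sd * (Num.sqrt n%:R * score_norm (S n) / score_sum (S n)) =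
  Num.sqrt n%:R * (y * (sd * score_norm (S n))) / score_sum (S n) by ring.
rewrite ler_pdivrMr // -[leRHS]mulrA ler_pM2l //.
by rewrite sqrtr_gt0 ltr0n.
Qed.

Let le_k n x : (0 < n)%N -> (kappa n <= k x n) = (Num.sqrt n%:R * (kappa n - k0) <= x).
Proof.
move=> n0; have sn0 : 0 < Num.sqrt (n%:R : R) by rewrite sqrtr_gt0 ltr0n.
by rewrite -[in RHS]subr_le0 -scaled_sub // pmulr_rle0 // subr_le0.
Qed.

Let Phibar_shift y : (y < Phibar_inv alpha -> alpha < Phibar y) /\
  (Phibar_inv alpha < y -> Phibar y < alpha).
Proof.
rewrite -{2 4}(Phibar_invK alpha01) /Phibar; split => h.
  by rewrite ltrD2l ltrN2 Phi_lt.
by rewrite ltrD2l ltrN2 Phi_lt.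
Qed.

(** A perturbation [r] of the normal quantile that moves the limiting threshold by less than [e];
    the [+ 1] in the witness covers a vanishing [Num.sqrt sigma2]. *)
Let slack e : 0 < e -> exists2 r, 0 < r & r * sd * Num.sqrt sigma2 < e.
Proof.
move=> e0; have c0 : 0 <= sd * Num.sqrt sigma2 by rewrite mulr_ge0 ?sqrtr_ge0 // ltW.
exists (e / (sd * Num.sqrt sigma2 + 1)); first by rewrite divr_gt0 // ltr_wpDl.
rewrite -mulrA mulrAC ltr_pdivrMr ?ltr_wpDl //.
by rewrite ltr_pM2l // ltrDl.
Qed.

(** A small [T n] puts the observed threshold below [y] standard deviations, with [y] slightly under
    the [alpha] quantile. The p-value bound at [k x n] then exceeds [alpha] for large [n], so
    [k x n] bounds [kappa n]. *)
Lemma sensitivity_eventually_le x e : 0 < e -> \forall n \near \oo,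
  Num.sqrt n%:R * (T n - k0) <= x + shift - e ->
  Num.sqrt n%:R * (kappa n - k0) <= x.
Proof.
move=> e0; have [r r0 re] := slack e0.
pose y := Phibar_inv alpha - r.
have ay : alpha < Phibar y by apply: (Phibar_shift y).1; rewrite ltrBlDr ltrDl.
have lty : shift - e < y * sd * Num.sqrt sigma2.
  by rewrite /y /shift !mulrBl; lra.
near=> n => Tn.
have S0 : 0 < score_sum (S n) by near: n; exact: S_pos.
have kn : 0 < k x n < 1 by near: n; exact: k_itv.
have n0 := score_sum_gt0_size S0.
rewrite -le_k //; apply: transformed_sensitivity_value_le => //.
rewrite pvalue_boundE //; last by case/andP: kn.
apply: (@le_trans _ _ (bernoullis (k x n)
  [set b | y * (sd * score_norm (S n)) <= centred_sum (S n) (k x n) b])).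
  by apply: ltW; near: n; exact: (tail_eventually_gt k01 (k_cvg x) S_pos clt ay).
apply: bernoullis_subset; first by case/andP: kn => ? ?; rewrite !ltW.
move=> b /=; apply: le_trans; rewrite -thresholdE //.
apply: (@le_trans _ _ (shift - e)); first by rewrite -/(T n); lra.
by apply: ltW; near: n; exact: (cvgr_gt _ (@threshold_cvg y) _ lty).
Unshelve. all: by end_near. Qed.

Lemma sensitivity_eventually_gt x e : 0 < e -> \forall n \near \oo,
  x + shift + e <= Num.sqrt n%:R * (T n - k0) ->
  x < Num.sqrt n%:R * (kappa n - k0).
Proof.
move=> e0; have e2 : 0 < e / 2 by rewrite divr_gt0.
have [r r0 re] := slack e2.
pose y := Phibar_inv alpha + r.
(* Half of the margin goes to [x']: refuting [kappa n < k x' n], the strict form required below,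
   gives a strict conclusion at [x]. The other half absorbs the quantile perturbation. *)
pose x' := x + e / 2.
have xx' : x < x' by rewrite ltrDl.
have ay : Phibar y < alpha by apply: (Phibar_shift y).2; rewrite ltrDl.
have lty : y * sd * Num.sqrt sigma2 < shift + e / 2.
  by rewrite /y /shift !mulrDl; lra.
near=> n => Tn.
have S0 : 0 < score_sum (S n) by near: n; exact: S_pos.
have kn : 0 < k x' n < 1 by near: n; exact: k_itv.
have n0 := score_sum_gt0_size S0.
apply: (lt_le_trans xx'); rewrite leNgt; apply/negP => lt.
have {}lt : kappa n < k x' n.
  rewrite lt_neqAle le_k // (ltW lt) andbT; apply: contraTneq lt => ->.
  by rewrite /k addrAC subrr add0r mulrC divfK ?ltxx // gt_eqF // sqrtr_gt0 ltr0n.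
have a1 : alpha < 1 by case/andP: alpha01.
have := transformed_sensitivity_value_lt (@S_ge0 n) a1 kn lt.
rewrite pvalue_boundE //; last by case/andP: kn.
apply/negP; rewrite -ltNge.
apply: (@le_lt_trans _ _ (bernoullis (k x' n)
  [set b | y * (sd * score_norm (S n)) <= centred_sum (S n) (k x' n) b])); last first.
  by near: n; exact: (tail_eventually_lt k01 (k_cvg x') S_pos clt ay).
apply: bernoullis_subset; first by case/andP: kn => ? ?; rewrite !ltW.
move=> b /=; apply: le_trans; rewrite -thresholdE' //.
apply: (@le_trans _ _ (shift + e / 2)); last first.
  by move: Tn; rewrite -/(T n) /x'; lra.
by apply: ltW; near: n; exact: (cvgr_lt _ (@threshold_cvg y) _ lty).
Unshelve. all: by end_near. Qed.

End sensitivity_asymptotics.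

(** * Convergence in distribution *)

Section probability_limits.
Context {R : realType} {d : measure_display} {Om : measurableType d}.
Variable P : probability Om R.

(** The limit superior of the events is null, and [P (E n)] is at most the probability of the tail
    union, which decreases to it by continuity from above. *)
Lemma ae_eventually_cvg0 (E : nat -> set Om) : (forall n, measurable (E n)) ->
  {ae P, forall w, \forall n \near \oo, ~ E n w} ->
  P (E n) @[n --> \oo] --> 0%E.
Proof.
move=> mE aeE.
have mL : measurable (lim_sup_set E).
  by apply: bigcap_measurable => // k _; exact: bigcup_measurable.
have PL : P (lim_sup_set E) = 0%E.
  apply/negligibleP => //; apply: negligibleS aeE => w Lw [N _ h].
  have [m /= Nm Em] := Lw N I.
  exact: h Em.
have lim : P (\bigcup_(k >= n) E k) @[n --> \oo] --> 0%E.
  rewrite -PL; apply: lim_sup_set_cvg => //.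
  by rewrite (le_lt_trans (probability_le1 _ _)) ?ltry //; exact: bigcup_measurable.
apply: (squeeze_cvge _ (cvg_cst 0%E) lim); apply: nearW => n; rewrite measure_ge0 /=; apply: le_measure.
- by rewrite inE.
- by rewrite inE; exact: bigcup_measurable.
- by move=> w Ew; exists n => //=.
Qed.

Lemma cvg_sandwich (u : nat -> R) (G : R -> R) (c : R) : {for c, continuous G} ->
  (forall e, 0 < e -> \forall n \near \oo, G (c - e) - e <= u n <= G (c + e) + e) ->
  u n @[n --> \oo] --> G c.
Proof.
move=> Gc h; apply/cvgrPdist_le => e e0.
have e2 : 0 < e / 2 by rewrite divr_gt0.
have near_Gc : \forall z \near c, `|G z - G c| <= e / 2.
  exact: (cvgr_distC_le _ _ Gc _ e2).
have /nbhs_ballP[r /= r0 near_c] := near_Gc.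
pose dl := Num.min (r / 2) (e / 2).
have dl0 : 0 < dl by rewrite lt_min !divr_gt0.
have dlr : dl < r by rewrite gt_min ltr_pdivrMr // ltr_pMr // ltr1n.
have dle : dl <= e / 2 by rewrite ge_min lexx orbT.
have h1 : `|G (c - dl) - G c| <= e / 2.
  by apply: near_c; rewrite /ball /= opprB addrC subrK gtr0_norm.
have h2 : `|G (c + dl) - G c| <= e / 2.
  by apply: near_c; rewrite /ball /= opprD addrA subrr add0r normrN gtr0_norm.
apply: filterS (h dl dl0) => n /andP[hl hu].
move: h1 h2; rewrite !ler_norml => /andP[h1 h1'] /andP[h2 h2'].
by apply/andP; split; lra.
Qed.

End probability_limits.

Section slutsky.
Context {R : realType} {d : measure_display} {Om : measurableType d}.
Variable P : probability Om R.
Variables (V K : nat -> Om -> R).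
Hypotheses (V_meas : forall n, measurable_fun [set: Om] (V n))
           (K_meas : forall n, measurable_fun [set: Om] (K n)).

Let mle (W : nat -> Om -> R) n x : (forall n, measurable_fun [set: Om] (W n)) ->
  measurable [set w | W n w <= x].
Proof.
move=> /(_ n) mW; have := mW measurableT `]-oo, x]%classic; rewrite setTI.
by rewrite preimage_itvNyc; apply; exact: measurable_itv.
Qed.

(** The events where the implication fails almost surely stop occurring, so their probabilities tend
    to 0. This turns a pathwise comparison into one of distribution functions, although the rank
    from which it holds depends on the realization. *)
Lemma prob_le_eventually x v e :
  0 < e ->
  {ae P, forall w, \forall n \near \oo, V n w <= v -> K n w <= x} ->
  \forall n \near \oo,
    fine (P [set w | V n w <= v]) - e <= fine (P [set w | K n w <= x]).
Proof.
move=> e0 ae.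
pose E n := [set w | V n w <= v] `\` [set w | K n w <= x].
have mE n : measurable (E n) by apply: measurableD; exact: mle.
have E0 : {ae P, forall w, \forall n \near \oo, ~ E n w}.
  by apply: filterS ae => w; apply: filterS => n h [/h].
have /fine_cvgP[_ /= lim] := ae_eventually_cvg0 mE E0.
near=> n.
have En : fine (P (E n)) < e by near: n; exact: (cvgr_lt _ lim).
suff : fine (P [set w | V n w <= v]) <=
    fine (P (E n)) + fine (P [set w | K n w <= x]) by lra.
rewrite -fineD ?fin_num_measure //; try exact: mle.
apply: fine_le; rewrite ?fin_numD ?fin_num_measure //; try exact: mle.
apply: le_trans (measureU2 _ _ _) => //; last exact: mle.
apply: le_measure; rewrite ?inE; [exact: mle|apply: measurableU => //; exact: mle|].
by move=> w Vw; have [Kw|Kw] := pselect (K n w <= x); [right|left].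
Unshelve. all: by end_near. Qed.

End slutsky.

Section standard_normal_limit.
Context {R : realType} {d : measure_display} {Om : measurableType d}.
Variable P : probability Om R.

Lemma cvg_normal_cdf (V : nat -> Om -> R) v :
  cvg_in_distribution P V (normal_prob 0 1) ->
  fine (P [set w | V n w <= v]) @[n --> \oo] --> Phi v.
Proof.
move=> [_ /(_ v (normal_prob_set1 0 1 v))].
rewrite /= (normal_probNy 0 v ltr01) subr0 divr1 => /fine_cvg.
by under eq_fun do rewrite preimage_itvNyc.
Qed.

(** If [mu <= 0] the standardized statistic is never negative, forcing [Phi (-1) = 0]; if [mu >= 1]
    it is never positive, forcing [Phi 0 = 1]. Both contradict the strict monotonicity of [Phi],
    whose values lie in [[0, 1]]. *)
Lemma clt_mean_itv (T : nat -> Om -> R) (mu sigma : R) : 0 < sigma ->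
  (forall n w, 0 <= T n w <= 1) ->
  cvg_in_distribution P (fun n w => Num.sqrt n%:R * ((T n w - mu) / sigma))
    (normal_prob 0 1) ->
  0 < mu < 1.
Proof.
move=> s0 T01 /cvg_normal_cdf lim.
have prob_cst v b : (forall n w, (Num.sqrt n%:R * ((T n w - mu) / sigma) <= v) = b) ->
    Phi v = b%:R.
  move=> Vb; have := lim v; rewrite (_ : (fun n => _) = cst b%:R).
    by move/cvg_lim => <- //; rewrite lim_cst.
  apply/funext => n; case: b Vb => Vb.
    rewrite [X in P X](_ : _ = setT) ?probability_setT //.
    by apply/seteqP; split => w //= _; rewrite Vb.
  rewrite [X in P X](_ : _ = set0) ?measure0 //.
  by apply/seteqP; split => w //=; rewrite Vb.
have r0 n : 0 <= Num.sqrt (n%:R : R) by exact: sqrtr_ge0.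
have Phi_itv : 0 <= Phi (-2 : R) by exact: fine_ge0.
have Phi_itv1 : Phi (1 : R) <= 1.
  by rewrite /Phi -[leRHS]/(fine 1%E) fine_le ?fin_num_measure // probability_le1.
apply/andP; split; rewrite ltNge; apply/negP => h.
  have /prob_cst : forall n w,
      (Num.sqrt n%:R * ((T n w - mu) / sigma) <= -1) = false.
    move=> n w; apply/negbTE; rewrite -ltNge (@lt_le_trans _ _ 0) ?ltrN10 //.
    rewrite mulr_ge0 // divr_ge0 ?(ltW s0) // subr_ge0 (le_trans h) //.
    by case/andP: (T01 n w).
  have : Phi (-2 : R) < Phi (-1) by apply: Phi_lt; lra.
  by move=> /[swap] ->; rewrite ltNge Phi_itv.
have /prob_cst : forall n w,
    (Num.sqrt n%:R * ((T n w - mu) / sigma) <= 0) = true.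
  move=> n w; rewrite mulr_ge0_le0 // mulr_le0_ge0 ?invr_ge0 ?(ltW s0) //.
  by rewrite subr_le0 (le_trans _ h) //; case/andP: (T01 n w).
have : Phi 0 < Phi (1 : R) by apply: Phi_lt; lra.
by move=> /[swap] ->; rewrite ltNge Phi_itv1.
Qed.

End standard_normal_limit.

Lemma measurable_diffs (R : realType) d (Om : measurableType d)
    (Z : nat -> 'I_2 -> Om -> bool) (rT rC : nat -> 'I_2 -> Om -> R) n :
  (forall i j, measurable_fun [set: Om] (Z i j)) ->
  (forall i j, measurable_fun [set: Om] (rT i j)) ->
  (forall i j, measurable_fun [set: Om] (rC i j)) ->
  measurable_fun [set: Om] (diffs Z rT rC n).
Proof.
move=> mZ mT mC; apply/measurable_fun_tnthP => i.
rewrite [X in measurable_fun _ X](_ : _ = pair_diff Z rT rC i); last first.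
  by apply/funext => w; rewrite /= tnth_mktuple.
have mZR a b : measurable_fun [set: Om] (fun w => (Z a b w)%:R : R).
  exact: (@measurableT_comp _ _ _ _ _ _ (fun b : bool => b%:R : R)).
have mO a b : measurable_fun [set: Om] (outcome Z rT rC a b).
  apply: measurable_funD; apply: measurable_funM => //.
  exact: measurable_funB.
by apply: measurable_funM; exact: measurable_funB.
Qed.

Lemma measurable_scores (R : realType) d (Om : measurableType d)
    (q : forall n, n.-tuple R -> n.-tuple R) n (Y : Om -> n.-tuple R) :
  score_function q -> measurable_fun [set: Om] Y ->
  measurable_fun [set: Om] (fun w => scores q (Y w)).
Proof.
move=> [mq _] /measurable_fun_tnthP mY.
apply: (@measurableT_comp _ _ _ _ _ _ (q n)); first exact: mq.
apply/measurable_fun_tnthP => i.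
rewrite [X in measurable_fun _ X](_ : _ = fun w => `|tnth (Y w) i|); last first.
  by apply/funext => w; rewrite /= tnth_mktuple.
by apply: measurableT_comp; [exact: normr_measurable|exact: mY].
Qed.

Lemma scores_ge0 (R : realType) (q : forall n, n.-tuple R -> n.-tuple R) n
    (y : n.-tuple R) i : score_function q -> 0 <= tnth (scores q y) i.
Proof.
by move=> [_ q0]; apply: (q0 _ _ _ i).1 => j; rewrite tnth_mktuple.
Qed.

Theorem theorem1 (R : realType)
    (d : measure_display) (Om : measurableType d) (P : probability Om R)
    (dX : measure_display) (X : measurableType dX)
    (dU : measure_display) (U : measurableType dU)
    (F : probability ((bool * bool) * (R * R))%type R)
    (Z : nat -> 'I_2 -> Om -> bool)
    (rT rC : nat -> 'I_2 -> Om -> R)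
    (x : nat -> 'I_2 -> Om -> X)
    (u : nat -> 'I_2 -> Om -> U)
    (q : forall n : nat, n.-tuple R -> n.-tuple R)
    (Z_meas : forall i j, measurable_fun [set: Om] (Z i j))
    (rT_meas : forall i j, measurable_fun [set: Om] (rT i j))
    (rC_meas : forall i j, measurable_fun [set: Om] (rC i j))
    (x_meas : forall i j, measurable_fun [set: Om] (x i j))
    (u_meas : forall i j, measurable_fun [set: Om] (u i j))
    (one_treated : forall i w, (Z i ord0 w + Z i ord_max w = 1)%N)
    (x_matched : forall i w, x i ord0 w = x i ord_max w)
    (assigned : randomly_assigned P Z
       (fun i j w => (rT i j w, rC i j w, x i j w, u i j w)))
    (data_iid : iid P (pair_data Z rT rC) F)
    (q_score : score_function q) :
  let Y n w := diffs Z rT rC n w in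
  let S n w := scores q (Y n w) in
  forall
    (S_pos : {ae P, forall w, \forall n \near \oo, 0 < score_sum (S n w)})
    (H1 : forall Gam : R, 0 < Gam ->
       {ae P, forall w,
          cvg_law (fun n => std_bounding_law Gam (S n w)) (normal_prob 0 1)})
    (sigma2_q : R)
    (H2 : {ae P, forall w, score_sigma2 (S n w) @[n --> \oo] --> sigma2_q})
    (mu_F sigma_F : R) (sigma_F_pos : 0 < sigma_F)
    (H3 : cvg_in_distribution P
       (fun n w =>
          Num.sqrt n%:R * ((signed_score (Y n w) (S n w) - mu_F) / sigma_F))
       (normal_prob 0 1))
    (alpha : R) (alpha01 : 0 < alpha < 1),
  cvg_in_distribution P
    (fun n w => Num.sqrt n%:R
       * (transformed_sensitivity_value alpha (Y n w) (S n w) - mu_F))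
    (normal_prob
       (- Num.sqrt sigma2_q * Phibar_inv alpha * Num.sqrt (mu_F * (1 - mu_F)))
       sigma_F).
Proof.
move=> Y S S_pos H1 sigma2_q H2 mu_F sigma_F sigma_F_pos H3 alpha alpha01.
have a1 : alpha < 1 by case/andP: alpha01.
have Y_meas n : measurable_fun [set: Om] (Y n) by exact: measurable_diffs.
have S_meas n : measurable_fun [set: Om] (S n) by exact: measurable_scores.
have S_ge0 n w i : 0 <= tnth (S n w) i by exact: scores_ge0.
have mu01 : 0 < mu_F < 1.
  apply: clt_mean_itv sigma_F_pos _ H3 => n w; exact: signed_score_itv.
pose kappa n w := transformed_sensitivity_value alpha (Y n w) (S n w).
pose K n w := Num.sqrt n%:R * (kappa n w - mu_F).
pose T n w := signed_score (Y n w) (S n w).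
pose V n w := Num.sqrt n%:R * ((T n w - mu_F) / sigma_F).
have V_meas n : measurable_fun [set: Om] (V n) by exact: H3.1.
have K_meas n : measurable_fun [set: Om] (K n).
  apply: measurable_funM => //; apply: measurable_funB => //.
  exact: measurable_transformed_sensitivity_value.
have VE n w : Num.sqrt n%:R * (T n w - mu_F) = V n w * sigma_F.
  by rewrite /V mulrA mulfVK // gt_eqF.
split=> // c _.
set sh := - _ * _ * _.
pose shift := Phibar_inv alpha * Num.sqrt (mu_F * (1 - mu_F)) * Num.sqrt sigma2_q.
have shE : sh = - shift by rewrite /sh /shift; ring.
rewrite /= normal_probNy // shE opprK.
suff lim : fine (P [set w | K n w <= c]) @[n --> \oo] --> Phi ((c + shift) / sigma_F).
  apply/fine_cvgP; split.
    by apply: nearW => n; rewrite fin_num_measure // -[X in measurable X]setTI; exact: K_meas.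
  by under eq_fun do rewrite /= preimage_itvNyc.
(* A single null set is discarded, off which all the pathwise assumptions hold at the one odds value
   [odds_of mu_F]. *)
have asym : {ae P, forall w,
  [/\ \forall n \near \oo, 0 < score_sum (S n w),
    score_sigma2 (S n w) @[n --> \oo] --> sigma2_q &
    cvg_law (fun n => std_bounding_law (odds_of mu_F) (S n w)) (normal_prob 0 1)]}.
  have aeF : Filter (almost_everywhere P) := ae_filter_ringOfSetsType P.
  have h := @filterI _ _ aeF _ _ S_pos
    (@filterI _ _ aeF _ _ H2 (H1 _ (odds_of_gt0 mu01))).
  by apply: (@filterS _ _ aeF _ _ _ h) => w [Sp [s2 clt]]; split;
    [exact: Sp|exact: s2|exact: clt].
apply: cvg_sandwich; first exact: continuous_Phi.
(* The pathwise lemmas speak of the unscaled statistic; a margin [e'] there is a margin [e] for [V],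
   which is divided by [sigma_F]. *)
move=> e e0; pose e' := e * sigma_F.
have e'0 : 0 < e' by rewrite mulr_gt0.
have e2 : 0 < e / 2 by rewrite divr_gt0.
have lower : {ae P, forall w, \forall n \near \oo,
    V n w <= (c + shift) / sigma_F - e -> K n w <= c}.
  apply: filterS asym => w [Sp s2 clt].
  have := sensitivity_eventually_le (fun n => Y n w) mu01 alpha01 Sp s2 clt c e'0.
  apply: filterS => n h Vn; apply: h; rewrite VE.
  by rewrite -ler_pdivlMr // mulrBl /e' mulfK // gt_eqF.
have upper : {ae P, forall w, \forall n \near \oo,
    K n w <= c -> V n w <= (c + shift) / sigma_F + e}.
  apply: filterS asym => w [Sp s2 clt].
  have := sensitivity_eventually_gt (fun n => Y n w) mu01 alpha01
    (fun n => S_ge0 n w) Sp s2 clt c e'0.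
  apply: filterS => n h; rewrite leNgt; apply: contraNle => /ltW Vn; apply: h.
  by rewrite VE -ler_pdivrMr // mulrDl /e' mulfK // gt_eqF.
have limV v : fine (P [set w | V n w <= v]) @[n --> \oo] --> Phi v.
  exact: cvg_normal_cdf.
have low := prob_le_eventually V_meas K_meas e2 lower.
have upp := prob_le_eventually K_meas V_meas e2 upper.
(* Each side of the sandwich costs [e / 2] for the exceptional events and [e / 2] for the
   convergence of the distribution function of [V]. *)
near=> n.
have lown : fine (P [set w | V n w <= (c + shift) / sigma_F - e]) - e / 2
    <= fine (P [set w | K n w <= c]) by near: n; exact: low.
have uppn : fine (P [set w | K n w <= c]) - e / 2
    <= fine (P [set w | V n w <= (c + shift) / sigma_F + e]) by near: n; exact: upp.
have dlow : `|Phi ((c + shift) / sigma_F - e)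
   - fine (P [set w | V n w <= (c + shift) / sigma_F - e])| <= e / 2.
  by near: n; exact: (cvgr_dist_le _ _ (limV _) _ e2).
have dupp : `|Phi ((c + shift) / sigma_F + e)
   - fine (P [set w | V n w <= (c + shift) / sigma_F + e])| <= e / 2.
  by near: n; exact: (cvgr_dist_le _ _ (limV _) _ e2).
move: dlow dupp; rewrite !ler_norml => /andP[l1 l2] /andP[u1 u2].
by apply/andP; split; lra.
Unshelve. all: by end_near. Qed.
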